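(* Let $V$ and $W$ be finite-dimensional real inner product spaces, let $A\colon V\to V$ be a symmetric positive definite linear operator, and let $B\colon V\to W$ be a surjective linear operator. Let $S = BA^{-1}B^t\colon W\to W$, and let $L\colon W\to W$ be a symmetric positive definite linear operator. Then $$\lambda_{\min}(LS)=\inf_{0\neq q\in W}\ \sup_{v\in V,\ Bv=q}\frac{(Lq,q)}{(Av,v)},\qquad \lambda_{\max}(LS)=\sup_{0\neq v\in V}\frac{(LBv,Bv)}{(Av,v)}.$$
   Context: All inner products are denoted $(\cdot,\cdot)$. $B^t\colon W\to V$ is the adjoint of $B$ with respect to these inner products. ''Symmetric positive definite'' means self-adjoint with $(Av,v)>0$ for all $v\ne 0$. $S=BA^{-1}B^t$ is the Schur complement of the saddle point system $Au+B^tp=f$, $Bu=g$ (with $f\in V$, $g\in W$), and $L$ plays the role of a preconditioner. $\lambda_{\min}$ and $\lambda_{\max}$ denote the minimum and maximum eigenvalues of an operator (so $W$ is understood to be nonzero); the operator $LS$ has real eigenvalues since it is a product of two symmetric positive definite operators. *)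

(* Defs.v *)
From HB Require Import structures.
From mathcomp Require Import all_boot all_order all_algebra.
From mathcomp Require Import all_classical all_reals all_analysis.

Set Implicit Arguments.
Unset Strict Implicit.
Unset Printing Implicit Defensive.

Import Order.TTheory GRing.Theory Num.Theory.
Local Open Scope ring_scope.
Local Open Scope classical_set_scope.

(* For [theta = idfun] the library's [{dot V for theta}] is the type of real
   inner products on [V]: symmetric, positive definite bilinear forms. *)

Definition is_adjoint (R : realType) (V W : vectType R)
    (dV : {dot V for idfun}) (dW : {dot W for idfun})
    (B : 'Hom(V, W)) (Bt : 'Hom(W, V)) : Prop :=
  forall (v : V) (q : W), dW (B v) q = dV v (Bt q).

(* The default value 0 of [xget] is never returned: see [adjointP]. *)
Definition adjoint (R : realType) (V W : vectType R)
    (dV : {dot V for idfun}) (dW : {dot W for idfun})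
    (B : 'Hom(V, W)) : 'Hom(W, V) :=
  xget 0 [set Bt | is_adjoint dV dW B Bt].

Definition sym_posdef (R : realType) (V : vectType R)
    (dV : {dot V for idfun}) (A : 'End(V)) : Prop :=
  (forall u v : V, dV (A u) v = dV u (A v)) /\
  (forall v : V, v != 0 -> 0 < dV (A v) v).

(* [passmx.leigenvalue T l] unfolds to [lker (T - l *: \1) != 0]. *)
Definition is_min_eigenvalue (R : realType) (V : vectType R)
    (T : 'End(V)) (l : R) : Prop :=
  passmx.leigenvalue T l /\ forall m : R, passmx.leigenvalue T m -> l <= m.

Definition is_max_eigenvalue (R : realType) (V : vectType R)
    (T : 'End(V)) (l : R) : Prop :=
  passmx.leigenvalue T l /\ forall m : R, passmx.leigenvalue T m -> m <= l.

Section AdjointExists.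
Variables (R : realType) (V W : vectType R).
Variables (dV : {dot V for idfun}) (dW : {dot W for idfun}).

Lemma dotC (u v : V) : dV u v = dV v u.
Proof. by rewrite (@hermitian_subproof _ _ _ _ dV) expr0 mul1r. Qed.

Definition dotl (v u : V) : R^o := dV u v.

Lemma dotl_linear (v : V) : linear (dotl v).
Proof. by move=> a x y; rewrite /dotl linearPl. Qed.

HB.instance Definition _ (v : V) :=
  GRing.isLinear.Build R V R^o *:%R (dotl v) (dotl_linear v).

Definition dot_lfun (v : V) : 'Hom(V, R^o) := linfun (dotl v).

Lemma dot_lfunE (u v : V) : dot_lfun v u = dV u v.
Proof. by rewrite lfunE. Qed.

Lemma dot_lfun_linear : linear dot_lfun.
Proof.
move=> a x y; apply/lfunP => u.
by rewrite add_lfunE scale_lfunE !dot_lfunE linearPr.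
Qed.

HB.instance Definition _ :=
  GRing.isLinear.Build R V 'Hom(V, R^o) *:%R dot_lfun dot_lfun_linear.

Lemma riesz (f : 'Hom(V, R^o)) : exists v, forall u, f u = dV u v.
Proof.
pose phi := linfun dot_lfun.
have ker0 : lker phi = 0%VS.
  apply/eqP/lker0P => x y; rewrite !lfunE /= => exy.
  apply/eqP; rewrite -subr_eq0; apply: contraT => /neq0_dnorm_gt0 => /(_ idfun dV).
  have eq_dot : dV (x - y) x = dV (x - y) y by rewrite -!dot_lfunE exy.
  by rewrite linearBr; rewrite [X in X - _]eq_dot subrr ltxx.
have full : limg phi = fullv.
  apply/eqP; rewrite eqEdim subvf /=.
  have := limg_ker_dim phi fullv.
  rewrite ker0 capv0 dimv0 add0n => ->.
  by rewrite !dimvf /dim /= muln1.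
have : f \in limg phi by rewrite full memvf.
by case/memv_imgP => v _ ->; exists v => u; rewrite lfunE /= dot_lfunE.
Qed.

End AdjointExists.

Lemma adjointP (R : realType) (V W : vectType R)
    (dV : {dot V for idfun}) (dW : {dot W for idfun}) (B : 'Hom(V, W)) :
  is_adjoint dV dW B (adjoint dV dW B).
Proof.
suff [Bt hBt] : exists Bt, is_adjoint dV dW B Bt.
  by rewrite /adjoint; case: xgetP => [_ _ //|/(_ Bt)].
have ex q := riesz dV (dot_lfun dW q \o B)%VF.
pose g q := sval (cid (ex q)).
have gE v q : dW (B v) q = dV v (g q).
  by rewrite /g; case: cid => z /= <-; rewrite comp_lfunE dot_lfunE.
have glin : linear g.
  move=> a x y; apply/eqP; rewrite -subr_eq0; apply: contraT.
  move=> /neq0_dnorm_gt0 => /(_ idfun dV); set d := (X in dV X _).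
  have eq_dot : dV d (g (a *: x + y)) = dV d (a *: g x + g y).
    by rewrite -gE !linearPr /= !gE.
  by rewrite linearBr; rewrite [X in X - _]eq_dot subrr ltxx.
pose gL := GRing.isLinear.Build R W V *:%R g glin.
pose G : {linear W -> V} := HB.pack g gL.
by exists (linfun G) => v q; rewrite lfunE /= gE.
Qed.

(* Main.v *)
Require Import Defs.
From HB Require Import structures.
From mathcomp Require Import all_boot all_order all_algebra.
From mathcomp Require Import all_classical all_reals all_analysis.
From mathcomp Require Import ring lra.

Set Implicit Arguments.
Unset Strict Implicit.
Unset Printing Implicit Defensive.

Import Order.TTheory GRing.Theory Num.Theory.
Import VectorInternalTheory numFieldNormedType.Exports.
Local Open Scope ring_scope.
Local Open Scope classical_set_scope.

(** Two facts give the theorem.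

    Energy minimisation: for [q = S x], the vector [v0 = A^-1 Bt x] lies in
    the fibre [B v = q], and it is [A]-orthogonal to the kernel of [B], because
    [(A v0, w) = (Bt x, w) = (x, B w)].  Hence it minimises [(A v, v)] on that
    fibre, with minimal value [(x, q) = (S x, x)] ([schur_min_energy],
    [schur_energy]).  Since [B] is surjective, [S] is positive definite
    ([schur_spd]), so every [q] has the form [S x] ([schur_surj]).
    The two right-hand sides of the theorem thus become the minimum and the
    maximum over nonzero [x] of the quotient [(L S x, S x) / (S x, x)].

    Rayleigh principle: when [L S x = l x], pairing with [S x] shows that this
    quotient equals [l] at [x], so its extreme values bound the eigenvalues.
    Conversely its maximum [l] exists by compactness ([rayleigh_quotient_max]);
    at a maximiser the positive semidefinite operator [l S - S L S] has an
    isotropic vector, which therefore lies in its kernel ([psd_isotropic_ker]),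
    and cancelling [S] gives an eigenvector of [L S]
    ([max_eigenvalue_sym_spd]).  The minimum is the same statement for [- L]
    ([min_eigenvalue_sym_spd]).

    Writing [q = S x] throughout keeps the inverse of [S] out of the
    quotients. *)

(** * Rayleigh quotients and the extreme eigenvalues of L S *)

Section Rayleigh.
Variables (R : realType) (W : vectType R) (dW : {dot W for idfun}).
Implicit Types (P M T L S : 'End(W)) (x y : W).

Lemma dotZl a x y : dW (a *: x) y = a * dW x y.
Proof. exact: linearZl_LR. Qed.

Lemma dotZr a x y : dW x (a *: y) = a * dW x y.
Proof. exact: linearZr_LR. Qed.

Lemma dot0l y : dW 0 y = 0. Proof. exact: linear0l. Qed.

Lemma dot_eq0 x : dW x x = 0 -> x = 0.
Proof.
move=> xx0; apply/eqP; apply: contraT => /neq0_dnorm_gt0.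
by move=> /(_ idfun dW); rewrite xx0 ltxx.
Qed.

(** The form is a polynomial in the coordinates; it is stated on row vectors
    because an abstract finite-dimensional space carries no topology. *)
Lemma continuous_quadratic_form P :
  continuous (fun c : 'rV[R]_(vector.dim W) => dW (P (r2v c)) (r2v c)).
Proof.
pose b i : W := r2v (delta_mx 0 i : 'rV[R]_(vector.dim W)).
have formE : (fun c : 'rV[R]_(vector.dim W) => dW (P (r2v c)) (r2v c)) =
    (fun c => \sum_i \sum_j c 0 i * (c 0 j * dW (P (b i)) (b j))).
  apply/funext => c.
  have -> : r2v c = \sum_i c 0 i *: b i.
    rewrite {1}(row_sum_delta c) linear_sum.
    by apply: eq_bigr => i _; rewrite linearZ.
  rewrite [P _]linear_sum /= linear_sumlz; apply: eq_bigr => i _.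
  rewrite linear_sumr; apply: eq_bigr => j _.
  by rewrite [P _]linearZ /= dotZl dotZr.
have contM (f g : 'rV[R]_(vector.dim W) -> R) :
    continuous f -> continuous g -> continuous (fun c => f c * g c).
  by move=> f_cont g_cont c; apply: continuousM; [exact: f_cont|exact: g_cont].
rewrite formE.
apply: continuous_big => [|i _]; first exact: add_continuous.
apply: continuous_big => [|j _]; first exact: add_continuous.
apply: (contM (fun c => c 0 i) (fun c => c 0 j * dW (P (b i)) (b j))).
  exact: coord_continuous.
apply: (contM (fun c => c 0 j) (fun=> dW (P (b i)) (b j))).
  exact: coord_continuous.
exact: cst_continuous.
Qed.

(** Both forms are homogeneous of degree 2, so the quotient is constant on
    rays, and it is enough to maximise it on the unit sphere of the coordinate
    space.  Any norm would do there; the one used is the sup norm of the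
    coordinates, which is unrelated to the inner product. *)
Lemma rayleigh_quotient_max P M :
  (0 < \dim {:W})%N -> (forall x, x != 0 -> 0 < dW (M x) x) ->
  exists2 x, x != 0 & forall y, y != 0 ->
    dW (P y) y / dW (M y) y <= dW (P x) x / dW (M x) x.
Proof.
rewrite dimvf => dim_gt0 M_gt0.
pose sphere := [set c : 'rV[R]_(vector.dim W) | `|c| = 1].
pose form T (c : 'rV[R]_(vector.dim W)) := dW (T (r2v c)) (r2v c).
pose quot c := form P c / form M c.
have r2v_neq0 (c : 'rV[R]_(vector.dim W)) : c != 0 -> (r2v c : W) != 0.
  by rewrite -(inj_eq (@r2v_inj _ W)) linear0.
have norm_unit (c : 'rV[R]_(vector.dim W)) : c != 0 -> `|(`|c|^-1 *: c)| = 1.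
  by move=> c0; rewrite normrZ normfV normr_id mulVf // normr_eq0.
have sphere_neq0 (c : 'rV[R]_(vector.dim W)) : sphere c -> c != 0.
  by move=> c1; rewrite -normr_eq0 c1 oner_neq0.
have sphere_nonempty : sphere !=set0.
  have c0 : const_mx 1 != 0 :> 'rV[R]_(vector.dim W).
    apply/eqP => /matrixP/(_ 0 (Ordinal dim_gt0)); rewrite !mxE.
    by apply/eqP; exact: oner_neq0.
  exists (`|const_mx 1 : 'rV[R]_(vector.dim W)|^-1 *: const_mx 1).
  exact: norm_unit.
have sphere_compact : compact sphere.
  apply: bounded_closed_compact.
    by exists 1; split=> // a a1 c /= ->; exact: ltW.
  apply: (@preimage_closed _ _ (fun c : 'rV[R]_(vector.dim W) => `|c|) [set 1]).
    by move=> c _; exact: norm_continuous.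
  exact: closed_eq.
have quot_continuous : {within sphere, continuous quot}.
  apply: continuous_in_subspaceT => c; rewrite inE => /sphere_neq0/r2v_neq0 c0.
  apply: (@continuousM _ _ (form P) (fun c => (form M c)^-1)).
    exact: continuous_quadratic_form.
  apply: continuousV; last exact: continuous_quadratic_form.
  by rewrite gt_eqF // M_gt0.
have [c] := EVT_max_rV sphere_nonempty sphere_compact quot_continuous.
rewrite inE => /sphere_neq0 c0 c_max.
exists (r2v c : W) => [|y y0]; first exact: r2v_neq0.
have y0' : v2r y != 0 by rewrite -(inj_eq (@r2v_inj _ W)) v2rK linear0.
have n0 : `|v2r y|^-1 != 0 by rewrite invr_eq0 normr_eq0.
have := c_max (`|v2r y|^-1 *: v2r y).
rewrite inE => /(_ (norm_unit _ y0')); rewrite /quot /form linearZ /= v2rK.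
rewrite [P _]linearZ [M _]linearZ /= !dotZl !dotZr !mulrA.
rewrite -mulf_div divff ?mul1r //.
by rewrite mulf_neq0.
Qed.

(** At a zero [x] of a nonnegative quadratic form the first variation in every
    direction vanishes; in the direction [T x] it is twice the squared norm
    of [T x]. *)
Lemma psd_isotropic_ker T x :
  (forall y z, dW (T y) z = dW y (T z)) -> (forall y, 0 <= dW (T y) y) ->
  dW (T x) x = 0 -> T x = 0.
Proof.
move=> T_sym T_ge0 Tx0; apply: dot_eq0.
set a := dW _ _; pose b := dW (T (T x)) (T x).
have b_ge0 : 0 <= b by exact: T_ge0.
have quad t : 0 <= 2 * t * a + t ^+ 2 * b.
  have := T_ge0 (x + t *: T x).
  rewrite [T (_ + _)]linearD /= [T (t *: _)]linearZ /=.
  rewrite linearDl !linearDr /= !dotZl !dotZr Tx0.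
  rewrite (T_sym (T x) x) -/a -/b.
  by congr (0 <= _); ring.
have b1 : 0 < b + 1 by lra.
(* The minimiser would be [- a / b]; using [b + 1] avoids the case [b = 0],
   and the value at this point is still negative unless [a = 0]. *)
have := quad (- (a / (b + 1))).
have -> : 2 * - (a / (b + 1)) * a + (- (a / (b + 1))) ^+ 2 * b =
  - (a / (b + 1)) ^+ 2 * (b + 2) by field; rewrite gt_eqF.
have b2 : 0 < b + 2 by lra.
rewrite mulNr oppr_ge0 pmulr_lle0 // => sq_le0.
have : (a / (b + 1)) ^+ 2 == 0 by rewrite eq_le sq_le0 sqr_ge0.
by rewrite sqrf_eq0 mulf_eq0 invr_eq0 (gt_eqF b1) orbF => /eqP.
Qed.

Lemma leigenvalueP T l :
  reflect (exists2 x, x != 0 & T x = l *: x) (passmx.leigenvalue T l).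
Proof.
have mem_eig x : (x \in passmx.leigenspace T l) = (T x == l *: x).
  by rewrite memv_ker add_lfunE opp_lfunE scale_lfunE id_lfunE subr_eq0.
apply: (iffP idP) => [|[x x0 Tx]].
  rewrite /passmx.leigenvalue -vpick0 => x0.
  exists (vpick (passmx.leigenspace T l)) => //.
  by apply/eqP; rewrite -mem_eig memv_pick.
apply: contraNneq x0 => ker0.
by rewrite -memv0 -ker0 mem_eig Tx.
Qed.

(** [L S] is self-adjoint not for [dW] but for the inner product [(S x, y)],
    and [(S L S x, x) / (S x, x)] is its Rayleigh quotient there.  The lemma
    asks of [L] only symmetry so that it also applies to [- L]. *)
Lemma max_eigenvalue_sym_spd L S :
    (0 < \dim {:W})%N -> (forall x y, dW (L x) y = dW x (L y)) ->
    sym_posdef dW S ->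
  exists2 l, is_max_eigenvalue (L \o S)%VF l &
    forall y, dW (L (S y)) (S y) <= l * dW (S y) y.
Proof.
move=> dim_gt0 L_sym [S_sym S_gt0].
have [x x0 x_max] := rayleigh_quotient_max (S \o L \o S)%VF dim_gt0 S_gt0.
set l := _ / _ in x_max.
have SLSE y : dW ((S \o L \o S)%VF y) y = dW (L (S y)) (S y).
  by rewrite !comp_lfunE S_sym.
have l_max y : dW (L (S y)) (S y) <= l * dW (S y) y.
  have [->|y0] := eqVneq y 0; first by rewrite [S 0]linear0 !linear0r.
  by rewrite -ler_pdivrMr ?S_gt0 // -SLSE; exact: x_max.
exists l => //; split=> [|m /leigenvalueP[y y0 LSy]].
  apply/leigenvalueP; exists x => //.
  pose T := (l *: S - (S \o L \o S))%VF.
  have TE y : T y = l *: S y - S (L (S y)).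
    by rewrite add_lfunE opp_lfunE scale_lfunE !comp_lfunE.
  have Tform y : dW (T y) y = l * dW (S y) y - dW (L (S y)) (S y).
    by rewrite TE linearBl /= dotZl (S_sym (L _)).
  have Tx0 : T x = 0.
    apply: psd_isotropic_ker => [y z|y|].
    - by rewrite !TE linearBl linearBr /= dotZl dotZr !S_sym L_sym S_sym.
    - by rewrite Tform subr_ge0.
    - by rewrite Tform /l SLSE divfK ?subrr // gt_eqF ?S_gt0.
  (* [T x = 0] says that [S] kills [L (S x) - l *: x], and [S] is definite. *)
  apply/eqP; rewrite -subr_eq0; apply: contraT => /S_gt0.
  have -> : S ((L \o S)%VF x - l *: x) = 0.
    by rewrite linearB linearZ /= comp_lfunE -opprB -TE Tx0 oppr0.
  by rewrite dot0l ltxx.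
have := l_max y; rewrite -comp_lfunE LSy dotZl -S_sym ler_pM2r //.
exact: S_gt0.
Qed.

Lemma min_eigenvalue_sym_spd L S :
    (0 < \dim {:W})%N -> (forall x y, dW (L x) y = dW x (L y)) ->
    sym_posdef dW S ->
  exists2 l, is_min_eigenvalue (L \o S)%VF l &
    forall y, l * dW (S y) y <= dW (L (S y)) (S y).
Proof.
move=> dim_gt0 L_sym S_spd.
have NL_sym x y : dW ((- L)%VF x) y = dW x ((- L)%VF y).
  by rewrite !opp_lfunE linearNl linearNr /= L_sym.
have [l [l_eig l_max] l_ray] := max_eigenvalue_sym_spd dim_gt0 NL_sym S_spd.
have eigN m : passmx.leigenvalue (L \o S)%VF m ->
    passmx.leigenvalue ((- L) \o S)%VF (- m).
  move=> /leigenvalueP[x x0 xE]; apply/leigenvalueP; exists x => //.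
  by rewrite comp_lfunE opp_lfunE -comp_lfunE xE scaleNr.
exists (- l) => [|y].
  split=> [|m /eigN/l_max]; last by rewrite lerNl.
  have /leigenvalueP[x x0 xE] := l_eig; apply/leigenvalueP; exists x => //.
  by rewrite scaleNr -xE !comp_lfunE opp_lfunE opprK.
by have := l_ray y; rewrite opp_lfunE linearNl /= mulNr lerNl.
Qed.

End Rayleigh.

(** * The Schur complement as a minimal energy *)

Section Schur.
Variables (R : realType) (V W : vectType R).
Variables (dV : {dot V for idfun}) (dW : {dot W for idfun}).
Variables (A : 'End(V)) (B : 'Hom(V, W)).
Hypotheses (A_spd : sym_posdef dV A) (B_surj : limg B = fullv).
Let Bt := adjoint dV dW B.
Let S : 'End(W) := (B \o A^-1 \o Bt)%VF.

Lemma posdef_invK : cancel A^-1%VF A.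
Proof.
have [_ A_gt0] := A_spd.
apply: lker0_lfunVK; apply/lker0P => u v Auv.
apply/eqP; rewrite -subr_eq0; apply: contraT => /A_gt0.
by rewrite [A _]linearB /= Auv subrr dot0l ltxx.
Qed.

Lemma schurE x : S x = B (A^-1%VF (Bt x)).
Proof. by rewrite !comp_lfunE. Qed.

(** The [A]-inner product with [A^-1 Bt x] only sees [v] through [B v]; this is
    the orthogonality of [A^-1 Bt x] to the kernel of [B]. *)
Lemma dot_schur x v : dV (A v) (A^-1%VF (Bt x)) = dW (B v) x.
Proof.
by have [A_sym _] := A_spd; rewrite A_sym posdef_invK (adjointP dV dW B).
Qed.

Lemma adjoint_eq0 x : Bt x = 0 -> x = 0.
Proof.
move=> Btx0; apply: (@dot_eq0 _ _ dW).
have /memv_imgP[v _ {1}->] : x \in limg B by rewrite B_surj memvf.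
by rewrite (adjointP dV dW B) -/Bt Btx0 linear0r.
Qed.

Lemma schur_energy x :
  dW (S x) x = dV (A (A^-1%VF (Bt x))) (A^-1%VF (Bt x)).
Proof. by rewrite dot_schur schurE. Qed.

Lemma schur_spd : sym_posdef dW S.
Proof.
have [A_sym A_gt0] := A_spd.
split=> [x y|x x0].
  by rewrite schurE -dot_schur A_sym dotC dot_schur -schurE dotC.
rewrite schur_energy; apply: A_gt0; apply: contraNneq x0 => Ax0.
by apply/eqP/adjoint_eq0; rewrite -[Bt x]posdef_invK Ax0 linear0.
Qed.

Lemma schur_surj q : exists x, S x = q.
Proof.
have [_ S_gt0] := schur_spd.
have S_inj : lker S == 0%VS.
  apply/lker0P => x y Sxy.
  apply/eqP; rewrite -subr_eq0; apply: contraT => /S_gt0.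
  by rewrite [S _]linearB /= Sxy subrr dot0l ltxx.
by exists (S^-1%VF q); rewrite lker0_lfunVK.
Qed.

(** With [v0 = A^-1 Bt x] one has [(A v, v0) = (S x, x)] for every [v] in the
    fibre, so [(A (v - v0), v - v0) = (A v, v) - (S x, x)], and the left-hand
    side is nonnegative. *)
Lemma schur_min_energy x v : B v = S x -> dW (S x) x <= dV (A v) v.
Proof.
have [A_sym A_gt0] := A_spd.
move=> BvSx; set v0 := A^-1%VF (Bt x).
have A_ge0 : 0 <= dV (A (v - v0)) (v - v0).
  have [->|] := eqVneq (v - v0) 0; first by rewrite linear0r.
  by move=> /A_gt0/ltW.
rewrite -subr_ge0; apply: le_trans A_ge0 _.
rewrite [A _]linearB /= linearBl !linearBr /= (A_sym v0 v) (dotC dV v0).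
rewrite !dot_schur BvSx -schurE; lra.
Qed.

(** The numerator is constant on the fibre, so the supremum is attained where
    the energy is least, at [A^-1 Bt x]. *)
Lemma ereal_sup_fiber x c : x != 0 -> 0 <= c ->
  ereal_sup [set (c / dV (A v) v)%:E | v in [set v : V | B v = S x]] =
  (c / dW (S x) x)%:E.
Proof.
have [_ S_gt0] := schur_spd.
move=> /S_gt0 Sx_gt0 c_ge0; apply/eqP; rewrite eq_le; apply/andP; split.
  apply: ge_ereal_sup => _ [v /= BvSx <-]; rewrite lee_fin.
  apply: ler_wpM2l => //; have Sx_le := schur_min_energy BvSx.
  by rewrite lef_pV2 // posrE (lt_le_trans Sx_gt0).
apply: ereal_sup_ubound; exists (A^-1%VF (Bt x)); first by rewrite /= schurE.
by rewrite -schur_energy.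
Qed.

End Schur.

(** * The inf-sup characterisation *)

Theorem theorem4p3 (R : realType) (V W : vectType R)
    (dV : {dot V for idfun}) (dW : {dot W for idfun})
    (A : 'End(V)) (B : 'Hom(V, W)) (L : 'End(W))
    (W_neq0 : (0 < \dim {:W})%N)
    (A_spd : sym_posdef dV A)
    (B_surj : limg B = fullv)
    (L_spd : sym_posdef dW L) :
  let S : 'End(W) := (B \o A^-1 \o adjoint dV dW B)%VF in
  (exists2 lmin : R, is_min_eigenvalue (L \o S)%VF lmin &
     lmin%:E =
     ereal_inf [set ereal_sup [set (dW (L q) q / dV (A v) v)%:E
                                 | v in [set v : V | B v = q]]
                 | q in [set q : W | q != 0]]) /\
  (exists2 lmax : R, is_max_eigenvalue (L \o S)%VF lmax &
     lmax%:E =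
     ereal_sup [set (dW (L (B v)) (B v) / dV (A v) v)%:E
                 | v in [set v : V | v != 0]]).
Proof.
move=> S.
have [A_sym A_gt0] := A_spd; have [L_sym L_gt0] := L_spd.
have S_spd : sym_posdef dW S by exact: schur_spd.
have [S_sym S_gt0] := S_spd.
have S_neq0 x : x != 0 -> S x != 0.
  by move=> /S_gt0; apply: contraTneq => ->; rewrite dot0l ltxx.
have L_ge0 q : 0 <= dW (L q) q.
  by have [->|/L_gt0/ltW//] := eqVneq q 0; rewrite linear0r.
have eigenvector_quotient l : passmx.leigenvalue (L \o S)%VF l ->
    exists2 x, x != 0 & dW (L (S x)) (S x) / dW (S x) x = l.
  move=> /leigenvalueP[x x0 LSx]; exists x => //.
  by rewrite -comp_lfunE LSx dotZl -S_sym mulfK // gt_eqF ?S_gt0.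
split.
  have [l l_min l_le] := min_eigenvalue_sym_spd W_neq0 L_sym S_spd.
  exists l => //; apply/eqP; rewrite eq_le; apply/andP; split.
    apply: le_ereal_inf_tmp => _ [q /= q0 <-].
    have [x SxE] := schur_surj dW A_spd B_surj q.
    have x0 : x != 0 by apply: contraNneq q0 => x0; rewrite -SxE x0 linear0.
    rewrite -SxE ereal_sup_fiber // lee_fin ler_pdivlMr; first exact: l_le.
    exact: S_gt0.
  have [/eigenvector_quotient[x x0 xE] _] := l_min.
  apply: ereal_inf_lbound; exists (S x); first exact: S_neq0.
  by rewrite ereal_sup_fiber // xE.
have [l l_max l_ge] := max_eigenvalue_sym_spd W_neq0 L_sym S_spd.
have [/eigenvector_quotient[x x0 xE] _] := l_max.
exists l => //; apply/eqP; rewrite eq_le; apply/andP; split.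
  apply: ereal_sup_ubound; exists (A^-1%VF (adjoint dV dW B x)) => /=.
    apply: contraNneq (S_neq0 _ x0) => v0.
    by rewrite /S schurE v0 linear0.
  by rewrite -schurE -schur_energy // xE.
apply: ge_ereal_sup => _ [v /= v0 <-]; rewrite lee_fin.
(* [B v] may vanish although [v] does not; the fibre bound then still applies,
   with [y = 0]. *)
have [y SyE] := schur_surj dW A_spd B_surj (B v).
have l_ge0 : 0 <= l.
  by rewrite -xE divr_ge0 // ltW ?S_gt0.
rewrite ler_pdivrMr ?A_gt0 // -SyE.
apply: le_trans (l_ge y) _; apply: ler_wpM2l => //.
exact: schur_min_energy.
Qed.
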